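(* Let $a>0$, $b>0$ be real numbers and consider the complex list of $n$ elements (so $n\geq 3$ is odd) $$\sigma=(\lambda_1,-a+bi,-a-bi,\ldots,-a+bi,-a-bi),$$ consisting of a real number $\lambda_1\geq\sqrt{a^2+b^2}$ together with $\frac{n-1}{2}$ copies of the conjugate pair $-a+bi,\,-a-bi$. Then $\sigma$ is realizable by an $n$-by-$n$ matrix if and only if $$\lambda_1\geq (n-1)a+n\max\Bigl\{0,\frac{b}{\sqrt{n}}-a\Bigr\}.$$
   Context: A list of $n$ complex numbers is realizable (by an $n$-by-$n$ matrix $A$) if it is the spectrum, counting multiplicities, of an entrywise nonnegative $n$-by-$n$ real matrix $A$. *)

(* Defs.v *)
From HB Require Import structures.
From mathcomp Require Import all_boot all_order all_algebra.
From mathcomp Require Import reals.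
From mathcomp Require Export complex.

Set Implicit Arguments.
Unset Strict Implicit.
Unset Printing Implicit Defensive.

Import Order.TTheory GRing.Theory Num.Theory.
Local Open Scope ring_scope.
Local Open Scope complex_scope.

(* The spectrum is taken with algebraic multiplicities; comparing degrees, this
   equation forces size s = n. *)
Definition has_spectrum (R : realType) (n : nat) (A : 'M[R]_n)
    (s : seq R[i]) : Prop :=
  char_poly (map_mx (real_complex R) A) = \prod_(z <- s) ('X - z%:P).

Definition realizable (R : realType) (n : nat) (s : seq R[i]) : Prop :=
  exists A : 'M[R]_n, (forall i j, 0 <= A i j) /\ has_spectrum A s.

Definition sigma (R : realType) (n : nat) (lambda1 a b : R) : seq R[i] :=
  lambda1%:C :: flatten (nseq (n.-1)./2 [:: (- a) +i* b; (- a) -i* b]).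

(* Main.v *)
(* Put mu = lambda1 + a.  Shifting a realizing matrix by a gives B with
   characteristic polynomial (X - mu) (X^2 + b^2)^m, n = 2m + 1, whose
   off-diagonal entries are nonnegative and whose diagonal entries are at least
   a.  Necessity: tr B = mu >= n a, and Cauchy-Schwarz on the diagonal gives
   (tr B)^2 <= n tr(B^2) with tr(B^2) = mu^2 - 2 m b^2, i.e. mu^2 >= n b^2.
   Together these two bounds are the claimed inequality.
   Sufficiency: with alpha = mu / n they say a <= alpha and b^2 <= n alpha^2.
   Then (X - 2 m alpha) q^m, q = (X + alpha)^2 + b^2, has no positive coefficient
   besides the leading one, so its companion matrix is nonnegative, and adding
   (alpha - a) I to it yields a realization. *)
Require Import Defs.
From HB Require Import structures.
From mathcomp Require Import all_boot all_order all_algebra.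
From mathcomp Require Import reals ring lra.

Import Order.TTheory GRing.Theory Num.Theory.
Local Open Scope ring_scope.

(** * Characteristic polynomials of shifted and squared matrices *)

Lemma char_poly_add_scalar (R : comNzRingType) n (A : 'M[R]_n) (s : R) :
  char_poly (A + s%:M) = char_poly A \Po ('X - s%:P).
Proof.
rewrite /char_poly -(det_map_mx (comp_poly ('X - s%:P))); congr (\det _).
apply/matrixP => i j; rewrite !mxE !rmorphB /= rmorphMn /= !comp_polyX comp_polyC.
by rewrite polyCD polyCMn; case: eqP => _; rewrite ?mulr1n ?mulr0n; ring.
Qed.

(* det (X^2 - A^2) = det (X - A) det (X + A) *)
Lemma char_poly_sqr (R : comNzRingType) n (A : 'M[R]_n) :
  char_poly (A *m A) \Po 'X^2 = (-1) ^+ n * (char_poly A * (char_poly A \Po - 'X)).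
Proof.
rewrite /char_poly -(det_map_mx (comp_poly 'X^2)) -(det_map_mx (comp_poly (- 'X))).
rewrite mulrCA -detZ -det_mulmx; congr (\det _).
have -> : map_mx (comp_poly 'X^2) (char_poly_mx (A *m A)) =
    'X^2%:M - map_mx polyC (A *m A).
  apply/matrixP => i j; rewrite !mxE rmorphB /= rmorphMn /= comp_polyX.
  by rewrite !comp_polyC.
have -> : -1 *: map_mx (comp_poly (- 'X)) (char_poly_mx A) =
    'X%:M + map_mx polyC A.
  apply/matrixP => i j; rewrite !mxE rmorphB /= rmorphMn /= comp_polyX.
  by rewrite comp_polyC mulNrn; ring.
rewrite /char_poly_mx map_mxM /= mulmxDr !mulmxBl -!scalar_mxM.
by rewrite (scalar_mxC 'X (map_mx _ A)) subrKA.
Qed.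

Lemma coefXM_deriv (R : nzRingType) (p : {poly R}) k :
  ('X * p^`())`_k = p`_k *+ k.
Proof. by rewrite coefXM; case: k => [|k] //=; rewrite coef_deriv. Qed.

(** * Coefficients of powers of a quadratic *)

Section Quadratic.
Variables (R : realFieldType) (alpha c : R).
Let q : {poly R} := ('X + alpha%:P) ^+ 2 + c%:P.

Lemma sqrXaddC_addC : q = ('X + (2 * alpha)%:P) * 'X + (alpha ^+ 2 + c)%:P.
Proof. by rewrite /q polyCD polyCM; ring. Qed.

Lemma size_sqrXaddC_addC : size q = 3%N.
Proof.
by rewrite sqrXaddC_addC size_MXaddC -size_poly_eq0 size_XaddC.
Qed.

Lemma monic_sqrXaddC_addC : q \is monic.
Proof.
rewrite sqrXaddC_addC monicE lead_coefDl ?lead_coefMX ?lead_coefXaddC //.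
by rewrite size_mulX -?size_poly_eq0 size_XaddC // ltnS (leq_trans (size_polyC_leq1 _)).
Qed.

Hypotheses (halpha : 0 <= alpha) (hc : 0 <= c).

Lemma coef_sqrXaddC_addC_exp_ge0 m k : 0 <= (q ^+ m)`_k.
Proof.
elim: m k => [|m IHm] k; first by rewrite expr0 coef1 ler0n.
rewrite exprS coefM; apply: sumr_ge0 => i _; apply: mulr_ge0 => //.
rewrite sqrXaddC_addC coefD coefC coefMX coefD coefX coefC.
by case: (val i) => [|[|[|j]]] /=; rewrite ?add0r ?addr0 ?mulr_ge0 ?addr_ge0 ?sqr_ge0 ?ler0n.
Qed.

Lemma deriv_sqrXaddC_addC_exp m :
  (q ^+ m.+1)^`() = (2 * m.+1)%:R *: (('X + alpha%:P) * q ^+ m).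
Proof.
have dq : q^`() = 2 *: ('X + alpha%:P).
  rewrite /q derivD derivC addr0 expr2 derivM derivD derivX derivC scaler_nat.
  by rewrite addr0 mul1r mulr1 mulr2n.
by rewrite deriv_exp /= dq -scalerAl scalerMnl -mulrnA.
Qed.

(* Since q - (X + alpha)^2 = c, the polynomial 2 m q^m - (X + alpha) (q^m)'
   equals 2 m c q^(m-1), which has nonnegative coefficients. *)
Lemma ler_coef_deriv_sqrXaddC_addC_exp m k :
  alpha * ((q ^+ m)`_k.+1 *+ k.+1) <= ((2 * m)%:R - k%:R) * (q ^+ m)`_k.
Proof.
case: m => [|m].
  by rewrite expr0 !coef1; case: k => [|k] /=; rewrite mul0rn ?mulr0 ?subrr ?mul0r.
have E : (2 * m.+1)%:R *: q ^+ m.+1 - ('X + alpha%:P) * (q ^+ m.+1)^`() =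
    ((2 * m.+1)%:R * c) *: q ^+ m.
  rewrite deriv_sqrXaddC_addC_exp -!mul_polyC exprS !polyCM.
  have -> : c%:P = q - ('X + alpha%:P) ^+ 2 by rewrite /q addrC addKr.
  ring.
have /(congr1 (fun p : {poly R} => p`_k)) := E.
rewrite coefB !coefZ mulrDl coefD coefXM_deriv coefCM coef_deriv mulrBl.
have : 0 <= (2 * m.+1)%:R * c * (q ^+ m)`_k.
  by rewrite !mulr_ge0 ?coef_sqrXaddC_addC_exp_ge0.
rewrite -(mulr_natl (_`_k)) => h1 h2; lra.
Qed.

Lemma coef_XsubC_mul_sqrXaddC_addC_exp_le0 m k : 0 < alpha ->
    c <= (2 * m).+1%:R * alpha ^+ 2 -> (k <= 2 * m)%N ->
  (('X - ((2 * m)%:R * alpha)%:P) * q ^+ m)`_k <= 0.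
Proof.
move=> alpha_gt0 cle km.
rewrite mulrBl coefB coefXM coefCM; case: k km => [|k] km /=.
  by rewrite sub0r oppr_le0 mulr_ge0 ?mulr_ge0 ?coef_sqrXaddC_addC_exp_ge0.
rewrite subr_le0.
case: m cle km => // m cle km.
(* The coefficient recurrence from q (q^m)' = 2 m (X + alpha) q^m; the previous
   lemma eliminates the highest coefficient from it. *)
have E : 'X * ('X * (q ^+ m.+1)^`()) + (2 * alpha)%:P * ('X * (q ^+ m.+1)^`()) +
    (alpha ^+ 2 + c)%:P * (q ^+ m.+1)^`() =
    (2 * m.+1)%:R *: ('X * q ^+ m.+1 + alpha%:P * q ^+ m.+1).
  transitivity (q * (q ^+ m.+1)^`()); first by rewrite sqrXaddC_addC; ring.
  by rewrite deriv_sqrXaddC_addC_exp -scalerAr exprS; congr (_ *: _); ring.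
have := ler_coef_deriv_sqrXaddC_addC_exp m.+1 k.+1.
have /(congr1 (fun p : {poly R} => p`_k.+1)) := E.
rewrite !(coefD, coefZ, coefCM) [('X * ('X * _))`_ _]coefXM !coefXM_deriv coefXM coef_deriv /=.
have := coef_sqrXaddC_addC_exp_ge0 m.+1 k.+1.
rewrite -ltnS in km.
have NK : k%:R + 1 <= (2 * m.+1)%:R :> R by rewrite natr1 ler_nat -ltnS.
move: cle NK; rewrite -[_.+1%:R]natr1.
move: (2 * m.+1)%N (q ^+ m.+1) => N Q.
rewrite -[Q`_k.+2 *+ _]mulr_natl.
rewrite -[Q`_k.+1 *+ _]mulr_natl -[Q`_k *+ _]mulr_natl -[k.+1%:R]natr1.
move: Q`_k Q`_k.+1 (_%:R * Q`_k.+2) N%:R k%:R => p0 p1 p2 M K.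
move=> hc2 KM p1ge0 H1 H2.
have d_ge0 : 0 <= alpha ^+ 2 + c by rewrite addr_ge0 ?sqr_ge0.
have u_ge0 : 0 <= (M - (K + 1)) * p1 by rewrite mulr_ge0 ?subr_ge0.
have H3 := ler_wpM2l d_ge0 H2.
have H4 : (alpha ^+ 2 + c) * ((M - (K + 1)) * p1) <=
    ((M + 2) * alpha ^+ 2) * ((M - (K + 1)) * p1).
  by apply: ler_wpM2r => //; lra.
(* Scaled by [alpha * (M - K)], the recurrence and the two bounds give [alpha * (M - K) * p0 <=
   alpha ^+ 2 * (2 * (K + 1) - M + (M + 2) * (M - (K + 1))) * p1]. The bracket is exactly
   [M * (M - K)], so cancelling leaves [p0 <= M * alpha * p1]. *)
have aMK : 0 < alpha * (M - K) by rewrite mulr_gt0 //; lra.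
have H5 := congr1 ( *%R alpha) H1.
rewrite -(ler_pM2l aMK); lra.
Qed.

End Quadratic.

Lemma exists_nonneg_char_poly (R : realFieldType) (m : nat) (alpha c : R) :
    0 < alpha -> 0 <= c -> c <= (2 * m).+1%:R * alpha ^+ 2 ->
  exists A : 'M[R]_((2 * m).+1), (forall i j, 0 <= A i j) /\
    char_poly A = ('X - ((2 * m)%:R * alpha)%:P) * (('X + alpha%:P) ^+ 2 + c%:P) ^+ m.
Proof.
move=> alpha_gt0 c_ge0 cle.
set f := _ * _.
have q_monic := monic_sqrXaddC_addC R alpha c.
have f_monic : f \is monic by rewrite monicMl ?monicXsubC // monic_exp.
have f_size : (size f).-1 = (2 * m).+1.
  rewrite size_monicM ?monicXsubC ?monic_neq0 ?monic_exp // size_XsubC.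
  by rewrite add2n /= polySpred ?monic_neq0 ?monic_exp // size_exp size_sqrXaddC_addC.
(* [companionmx f] has dimension [(size f).-1], so the dimension is rewritten before the witness is
   given. *)
suff : exists A : 'M[R]_((size f).-1), (forall i j, 0 <= A i j) /\ char_poly A = f.
  by rewrite f_size.
exists (companionmx f); split; last exact: companionmxK.
move=> i j; rewrite mxE; case: ifP => _; last exact: ler0n.
rewrite oppr_ge0 coef_XsubC_mul_sqrXaddC_addC_exp_le0 ?(ltW alpha_gt0) //.
by rewrite -ltnS -f_size ltn_ord.
Qed.

(** Each conjugate pair contributes a real quadratic factor, and embedding [R] into [R[i]] is
    injective on polynomials, so the rest can be done over [R]. *)
Lemma char_poly_sigma (R : realType) (m : nat) (a b lambda1 : R) (A : 'M[R]_((2 * m).+1)) :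
  has_spectrum A (sigma (2 * m).+1 lambda1 a b) <->
  char_poly A = ('X - lambda1%:P) * (('X + a%:P) ^+ 2 + (b ^+ 2)%:P) ^+ m.
Proof.
rewrite /has_spectrum -map_char_poly /sigma /= big_cons big_flatten big_nseq.
have -> : (2 * m)%N./2 = m by rewrite mul2n doubleK.
rewrite !big_cons big_nil /= mulr1 iter_mulr_1.
set P := _ * _ ^+ m; set Q := _ * _ ^+ m.
have <- : map_poly (real_complex R) Q = P.
  rewrite /Q /P rmorphM rmorphXn rmorphB rmorphD rmorphXn rmorphD /=.
  rewrite map_polyX !map_polyC /=; congr (_ * _ ^+ m).
  have -> : (Complex (- a) b) = - (real_complex R a) + (Complex 0 1) * real_complex R b.
    by simpc.
  have -> : (Complex (- a) (-b)) = - (real_complex R a) - (Complex 0 1) * real_complex R b.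
    by simpc.
  have ii : (Complex 0 1) ^+ 2 = -1 :> complex R by rewrite expr2; simpc.
  rewrite ?rmorphXn /= !(polyCD, polyCM, polyCN).
  have : (Complex 0 1 : complex R)%:P ^+ 2 = -1 by rewrite -polyC_exp ii polyCN.
  move: (Complex 0 1)%:P => i hi; ring: hi.
split=> [|-> //]; exact: map_poly_inj.
Qed.

Lemma comp_polyX2_inj (R : comNzRingType) : injective (comp_poly ('X^2 : {poly R})).
Proof.
move=> p q E; apply/polyP => i.
have := congr1 (fun r : {poly R} => r`_(2 * i)) E.
by rewrite !coef_comp_poly_Xn // dvdn_mulr // mulKn.
Qed.

(** * Traces of the shifted matrix and of its square *)

Section Shifted.
Variables (R : realFieldType) (m : nat) (mu c : R) (B : 'M[R]_((2 * m).+1)).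
Hypothesis charB : char_poly B = ('X - mu%:P) * ('X^2 + c%:P) ^+ m.

Let quad_comp : ('X^2 + c%:P) ^+ m = ('X + c%:P) ^+ m \Po 'X^2.
Proof. by rewrite rmorphXn rmorphD /= comp_polyX comp_polyC. Qed.

Lemma trace_of_char_poly : \tr B = mu.
Proof.
have h := char_poly_trace B (ltn0Sn _).
(* The polynomial [('X^2 + c%:P) ^+ m] is even and monic of degree 2m: it contributes 0 at index 2m
   - 1 and 1 at index 2m. *)
apply: oppr_inj; rewrite -h charB /= mulrBl coefB coefXM coefCM quad_comp.
rewrite !coef_comp_poly_Xn // dvdn_mulr // mulKn //.
have /monicP := monic_exp m (monicXaddC c).
rewrite lead_coefE size_exp size_XaddC mul1n => ->.
rewrite mulr1; case: (m) => [|k]; first by rewrite muln0 sub0r.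
by rewrite mulnS add2n -pred_Sn dvdn2 /= oddM /= sub0r.
Qed.

(** The eigenvalues of [B *m B] are the squares [mu ^+ 2], once, and [- c], 2m times;
    [char_poly_sqr] shows this without leaving [R]. *)
Lemma trace_sqr_of_char_poly : \tr (B *m B) = mu ^+ 2 - (2 * m)%:R * c.
Proof.
pose s := mu ^+ 2 :: nseq (2 * m) (- c).
have charBB : char_poly (B *m B) = \prod_(z <- s) ('X - z%:P).
  apply: comp_polyX2_inj; rewrite char_poly_sqr charB big_cons big_nseq iter_mulr_1.
  rewrite !(rmorphM, rmorphXn, rmorphB, rmorphD, rmorphN) /=.
  rewrite !(comp_polyX, comp_polyC, polyCN, polyC_exp).
  rewrite mulrNN -expr2 opprK -signr_odd oddS oddM /= expr1 [(2 * m)%N]mulnC exprM.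
  by ring.
have := char_poly_trace (B *m B) (ltn0Sn _).
have -> : (2 * m).+1.-1 = (size s).-1 by rewrite /= size_nseq.
rewrite charBB coefPn_prod_XsubC // => /oppr_inj <-.
by rewrite big_cons big_nseq iter_addr_0 mulNrn mulr_natl.
Qed.

Lemma sqr_trace_ge_of_char_poly : (0 < m)%N -> (forall i j, i != j -> 0 <= B i j) ->
  (2 * m).+1%:R * c <= mu ^+ 2.
Proof.
move=> m_gt0 B_ge0; pose N : R := (2 * m).+1%:R.
have N_gt0 : 0 < N by rewrite ltr0Sn.
have diag_le : \sum_i B i i ^+ 2 <= mu ^+ 2 - (2 * m)%:R * c.
  (* The discarded terms [B i j * B j i] are off-diagonal products, hence nonnegative. *)
  rewrite -trace_sqr_of_char_poly; apply: ler_sum => i _.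
  rewrite mxE (bigD1 i) //= -expr2 lerDl sumr_ge0 // => j ji.
  by rewrite mulr_ge0 ?B_ge0 // eq_sym.
(* Cauchy-Schwarz, as nonnegativity of the variance of the diagonal about its mean [mu / N]. *)
have var_ge0 : 0 <= \sum_i (B i i - mu / N) ^+ 2.
  by apply: sumr_ge0 => i _; rewrite sqr_ge0.
have varE : \sum_i (B i i - mu / N) ^+ 2 = \sum_i B i i ^+ 2 - mu ^+ 2 / N.
  under eq_bigr do rewrite sqrrB -mulr_natl.
  rewrite !big_split /= sumr_const card_ord sumrN -mulr_sumr -mulr_suml.
  have -> : \sum_i B i i = mu by exact: trace_of_char_poly.
  rewrite -[_ *+ (2 * m).+1]mulr_natl -/N; move: (\sum_i _) (N) N_gt0 => S N0 N0_gt0.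
  by field; rewrite lt0r_neq0.
have : mu ^+ 2 / N <= mu ^+ 2 - (2 * m)%:R * c
  by apply: le_trans diag_le; rewrite -subr_ge0 -varE.
rewrite ler_pdivrMr // => h.
(* As [N] is 2m + 1, [h] is the goal multiplied by 2m. *)
have M_gt0 : 0 < (2 * m)%:R :> R by rewrite ltr0n muln_gt0.
rewrite -(ler_pM2l M_gt0).
by move: h; rewrite /N -natr1; lra.
Qed.

End Shifted.

Theorem proposition11 (R : realType) (n : nat) (a b lambda1 : R)
    (ha : 0 < a) (hb : 0 < b) (hn : (3 <= n)%N) (hodd : odd n)
    (hlambda1 : Num.sqrt (a ^+ 2 + b ^+ 2) <= lambda1) :
  realizable n (sigma n lambda1 a b) <->
  (n%:R - 1) * a + n%:R * Num.max 0 (b / Num.sqrt n%:R - a) <= lambda1.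
Proof.
have [m nE m_gt0] : exists2 m, n = (2 * m).+1 & (0 < m)%N.
  exists n./2; last by rewrite half_gt0 (ltn_trans _ hn).
  by rewrite -[LHS]odd_double_half hodd mul2n.
rewrite {n hn hodd}nE; set N : R := (2 * m).+1%:R.
have N_gt0 : 0 < N by rewrite ltr0Sn.
have sN_gt0 : 0 < Num.sqrt N by rewrite sqrtr_gt0.
have sN2 : Num.sqrt N ^+ 2 = N by rewrite sqr_sqrtr ?ltW.
have lambda1_gt0 : 0 < lambda1.
  by apply: lt_le_trans hlambda1; rewrite sqrtr_gt0 addr_gt0 ?exprn_gt0.
pose mu := lambda1 + a.
have mu_gt0 : 0 < mu by rewrite addr_gt0.
(* Adding [a] to both sides turns the left one into the maximum of [N * a] and [Num.sqrt N * b]; the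
   second bound is squared, both sides being positive. *)
have condE : ((N - 1) * a + N * Num.max 0 (b / Num.sqrt N - a) <= lambda1) <->
    N * a <= mu /\ N * b ^+ 2 <= mu ^+ 2.
  have -> : (N * b ^+ 2 <= mu ^+ 2) = (N * (b / Num.sqrt N) <= mu).
    have -> : N * (b / Num.sqrt N) = Num.sqrt N * b.
      by rewrite -{1}sN2; field; exact: lt0r_neq0.
    rewrite -{1}sN2 -exprMn ler_pXn2r // nnegrE ltW // mulr_gt0 //.
  rewrite maxr_pMr ?(ltW N_gt0) // mulr0 /mu.
  split=> [|[h1 h2]].
    by case: (lerP 0) => h1 h2; split; lra.
  by case: (lerP 0); lra.
rewrite condE; split=> [[A [A_ge0 /char_poly_sigma charA]]|[h1 h2]].
  have charB : char_poly (A + a%:M) = ('X - mu%:P) * ('X^2 + (b ^+ 2)%:P) ^+ m.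
    rewrite char_poly_add_scalar charA.
    rewrite !(rmorphM, rmorphXn, rmorphB, rmorphD) /= !(comp_polyX, comp_polyC).
    rewrite subrK; congr (_ * _); ring.
  split.
    have -> : N * a = \sum_(i < (2 * m).+1) a by rewrite sumr_const card_ord mulr_natl.
    rewrite -(trace_of_char_poly _ _ _ _ _ charB).
    by apply: ler_sum => i _; rewrite !mxE eqxx lerDr.
  apply: (sqr_trace_ge_of_char_poly _ _ _ _ _ charB) => // i j /negPf ij.
  by rewrite !mxE ij addr0.
have [alpha alpha_gt0 alphaN] : exists2 alpha, 0 < alpha & alpha * N = mu.
  by exists (mu / N); rewrite ?divr_gt0 // divfK ?lt0r_neq0.
have a_le : a <= alpha by rewrite -(ler_pM2r N_gt0) alphaN mulrC.
have [||A [A_ge0 charA]] := @exists_nonneg_char_poly R m alpha (b ^+ 2) alpha_gt0.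
- exact: sqr_ge0.
- rewrite -/N -(ler_pM2l N_gt0).
  by have -> : N * (N * alpha ^+ 2) = mu ^+ 2 by rewrite -alphaN; ring.
exists (A + (alpha - a)%:M); split=> [i j|].
  by rewrite !mxE addr_ge0 // mulrn_wge0 // subr_ge0.
apply/char_poly_sigma; rewrite char_poly_add_scalar charA.
rewrite !(rmorphM, rmorphXn, rmorphB, rmorphD) /= !(comp_polyX, comp_polyC).
(* The shift moves the real root 2m [alpha] to [N * alpha - a], which is [mu - a]. *)
have <- : alpha - a + (2 * m)%:R * alpha = lambda1.
  by move: alphaN; rewrite /N -natr1 /mu; lra.
by rewrite !(polyCD, polyCN); congr (_ * _ ^+ _); ring.
Qed.
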